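(* Let $p$ be an odd prime and let $H,N$ be integers with $0\le H<H+N<p$. For $a\in\mathbb{F}_p$ let $$S(a,H,N)=\sum_{n=H+1}^{H+N}\mathbf{e}(a\,n!).$$ Then $$\sum_{a=0}^{p-1}|S(a,H,N)|^2\ll pN^{3/2}.$$
   Context: $\mathbf{e}(z)=\exp(2\pi i z/p)$. The implied constant is absolute. *)

(* Defs.v *)
From HB Require Import structures.
From mathcomp Require Export all_boot all_order all_algebra.
From mathcomp Require Export reals sequences exp trigo.
From mathcomp.real_closed Require Export complex.

Set Implicit Arguments.
Unset Strict Implicit.
Unset Printing Implicit Defensive.

Import Order.TTheory GRing.Theory Num.Theory.
Local Open Scope ring_scope.
Local Open Scope complex_scope.

(* The complex exponential, through Euler's formula. *)
Definition cexp (R : realType) (z : R[i]) : R[i] :=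
  (expR (complex.Re z))%:C * (cos (complex.Im z) +i* sin (complex.Im z)).

Definition eexp (R : realType) (p : nat) (z : R) : R[i] :=
  cexp ((2 * pi * z / p%:R) *i).

(* The element [a : 'F_p] is read through its representative in [0, p - 1];
   [eexp p] takes the same value at all integers congruent modulo [p]. *)
Definition fact_expsum (R : realType) (p : nat) (a : 'F_p) (H N : nat) : R[i] :=
  \sum_(H.+1 <= n < (H + N).+1) eexp p ((nat_of_ord a)%:R * (n`!)%:R : R).

(* Main.v *)
(** Orthogonality of the additive characters gives [sum_a |S(a)|^2 = p J], where
    [J] counts the pairs [(m, n)] in the interval with [m! = n! mod p].
    For [k > 0] the congruence [(n - k)! = n! mod p] says that [n] is a root of
    the monic polynomial [X (X - 1)...(X - k + 1) - 1], so it has at most [k]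
    solutions.  Cut the interval into [L] blocks of length [L], where [L] is
    about [sqrt N].  By Cauchy-Schwarz, [J] is at most [L] times the number of
    pairs lying moreover in a common block; those have difference less than [L],
    so there are at most [N + L^2] of them.  Hence [J << N^(3/2)]. *)

Require Import Defs.
From mathcomp Require Import zify ring lra.

Set Implicit Arguments.
Unset Strict Implicit.
Unset Printing Implicit Defensive.

Import Order.TTheory GRing.Theory Num.Theory.
Local Open Scope ring_scope.
Local Open Scope complex_scope.

Definition collisions (I : finType) (T : eqType) (f : I -> T) : nat :=
  (\sum_i \sum_j (f i == f j))%N.

Lemma sqrn_sum_leq (I : finType) (x : I -> nat) :
  ((\sum_i x i) ^ 2 <= #|I| * \sum_i x i ^ 2)%N.
Proof.
rewrite -(leq_pmul2l (isT : 0 < 2)%N).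
have -> : (2 * (#|I| * \sum_i x i ^ 2) =
    \sum_i \sum_j (x i ^ 2 + x j ^ 2))%N.
  under [RHS]eq_bigr do rewrite big_split /= sum_nat_const.
  by rewrite big_split /= sum_nat_const -big_distrr /= mul2n addnn.
rewrite -mulnn big_distrlr /= big_distrr /=; apply: leq_sum => i _.
rewrite big_distrr /=; apply: leq_sum => j _.
exact: (nat_Cauchy (x i) (x j)).1.
Qed.

Lemma collisions_fibers (I T : finType) (f : I -> T) :
  collisions f = (\sum_t (\sum_i (f i == t)) ^ 2)%N.
Proof.
under [RHS]eq_bigr do rewrite -mulnn big_distrlr /=.
rewrite [RHS]exchange_big /=; apply: eq_bigr => i _.
rewrite exchange_big /=; apply: eq_bigr => j _.
rewrite (bigD1 (f i)) //= eqxx mul1n big1 ?addn0 1?eq_sym // => t.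
by rewrite eq_sym => /negPf ->.
Qed.

Lemma collisions_refine (I T B : finType) (f : I -> T) (b : I -> B) :
  (collisions f <= #|B| * collisions (fun i => (f i, b i)))%N.
Proof.
rewrite !collisions_fibers.
rewrite -(pair_bigA _ (fun t c => (\sum_i ((f i, b i) == (t, c))) ^ 2)%N) /=.
rewrite big_distrr /=; apply: leq_sum => t _.
apply: leq_trans (sqrn_sum_leq _).
rewrite leq_sqr exchange_big /=; apply: leq_sum => i _.
by rewrite (bigD1 (b i)) //= xpair_eqE eqxx andbT leq_addr.
Qed.

Lemma eq_collisions (I : finType) (T U : eqType) (f : I -> T) (g : I -> U) :
  (forall i j, (f i == f j) = (g i == g j)) -> collisions f = collisions g.
Proof. by move=> fg; do 2!apply: eq_bigr => ? _; rewrite fg. Qed.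

Definition shift_collisions (T : eqType) (f : nat -> T) (N k : nat) : nat :=
  (\sum_(0 <= i < N - k) (f i == f (i + k)))%N.

Definition shift_sparse (T : eqType) (f : nat -> T) (N : nat) : Prop :=
  forall k, (0 < k)%N -> (shift_collisions f N k <= k)%N.

Lemma shift_collisionsS (T : eqType) (f : nat -> T) N k : (k <= N)%N ->
  shift_collisions f N.+1 k = (shift_collisions f N k + (f (N - k) == f N))%N.
Proof.
by move=> le_kN; rewrite /shift_collisions subSn // big_nat_recr //= subnK.
Qed.

Lemma collisions_ordS (T : eqType) (f : nat -> T) N :
  collisions (fun i : 'I_N.+1 => f i)
    = (collisions (fun i : 'I_N => f i) + 2 * \sum_(i < N) (f i == f N) + 1)%N.
Proof.
rewrite /collisions big_ord_recr /= big_ord_recr /= eqxx addnA; congr addn.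
under eq_bigr do rewrite big_ord_recr /=.
rewrite big_split /= -addnA mul2n -addnn; congr (_ + (_ + _))%N.
by apply: eq_bigr => i _; rewrite eq_sym.
Qed.

Lemma sum_shift_collisionsS (T : eqType) (f : nat -> T) N :
  (\sum_(1 <= k < N.+1) shift_collisions f N.+1 k
    = \sum_(1 <= k < N) shift_collisions f N k + \sum_(i < N) (f i == f N))%N.
Proof.
under eq_big_nat => k /andP[_ le_kN] do rewrite shift_collisionsS //.
rewrite big_split /=; congr addn.
  case: N => [|N]; first by rewrite !big_geq.
  by rewrite big_nat_recr //= /shift_collisions subnn (big_geq (leqnn 0)) addn0.
rewrite -(big_mkord xpredT (fun i => nat_of_bool (f i == f N))).
rewrite big_add1 [RHS]big_nat_rev /=; apply: eq_big_nat => i _.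
by rewrite add0n.
Qed.

Lemma collisions_shift (T : eqType) (f : nat -> T) N :
  collisions (fun i : 'I_N => f i)
    = (N + 2 * \sum_(1 <= k < N) shift_collisions f N k)%N.
Proof.
elim: N => [|N IHN]; first by rewrite /collisions big_ord0 big_geq.
by rewrite collisions_ordS IHN sum_shift_collisionsS; lia.
Qed.

Lemma shift_collisions_block_le (T : eqType) (f : nat -> T) N L k : (0 < L)%N ->
  (shift_collisions (fun i => (f i, i %/ L)) N k
     <= (k < L) * shift_collisions f N k)%N.
Proof.
move=> L_gt0; rewrite /shift_collisions big_distrr /=; apply: leq_sum => i _.
rewrite xpair_eqE; case: ltnP => [_|le_Lk].
  by rewrite mul1n; case: (f i == _); rewrite ?leq_b1.
have lt_div : (i %/ L < (i + k) %/ L)%N.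
  have := leq_div2r L (leq_add (leqnn i) le_Lk).
  by rewrite divnDr ?dvdnn // divnn L_gt0 addn1.
by rewrite (ltn_eqF lt_div) andbF.
Qed.

Lemma sum_nat_ltn N L :
  (\sum_(0 <= k < N | k < L) k = 'C(minn N L, 2))%N.
Proof.
rewrite -bin2_sum [RHS](big_nat_widen 0 _ N) ?geq_minl // [LHS]big_nat_cond.
rewrite [RHS]big_nat_cond; apply: eq_bigl => k.
by rewrite leq_min; case: (k < N)%N.
Qed.

Lemma collisions_block_le (T : eqType) (f : nat -> T) N L : (0 < L)%N ->
  shift_sparse f N ->
  (collisions (fun i : 'I_N => (f i, i %/ L)) <= N + L ^ 2)%N.
Proof.
move=> L_gt0 f_sparse; rewrite (collisions_shift (fun i => (f i, i %/ L)%N)).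
have sum_le : (\sum_(1 <= k < N) shift_collisions (fun i => (f i, i %/ L)) N k
    <= 'C(L, 2))%N.
  apply: leq_trans (leq_bin2l 2 (geq_minr N L)); rewrite -sum_nat_ltn.
  rewrite (big_nat_widenl 1 0) // big_mkcond [leqRHS]big_mkcond.
  apply: leq_sum => -[|k] _ //=.
  apply: leq_trans (shift_collisions_block_le f N _ L_gt0) _.
  by case: ltnP; rewrite ?mul1n // f_sparse.
rewrite leq_add2l (leq_trans (leq_mul (leqnn 2) sum_le)) // bin2 mul2n.
by rewrite halfK -mulnn (leq_trans (leq_subr _ _)) // leq_mul2l leq_pred orbT.
Qed.

Lemma collisions_blocks_le (T : finType) (f : nat -> T) N M L :
  (N <= M * L)%N -> (0 < L)%N -> shift_sparse f N ->
  (collisions (fun i : 'I_N => f i) <= M * (N + L ^ 2))%N.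
Proof.
move=> N_le L_gt0 f_sparse.
have block_lt (i : 'I_N) : (i %/ L < M)%N.
  by rewrite ltn_divLR // (leq_trans (ltn_ord i)).
have := collisions_refine (fun i : 'I_N => f i) (fun i => Ordinal (block_lt i)).
rewrite card_ord => /leq_trans -> //; rewrite leq_mul2l.
rewrite (eq_collisions (g := fun i : 'I_N => (f i, i %/ L)%N)) //.
by rewrite collisions_block_le ?orbT.
Qed.

Lemma powR32_sqrt (R : realType) (x : R) :
  0 <= x -> x `^ (3 / 2) = x * Num.sqrt x.
Proof.
move=> x_ge0; have -> : 3 / 2 = 1 + 2^-1 :> R by field.
rewrite powRD; last by apply/implyP => /eqP; lra.
by rewrite powRr1 // powR12_sqrt.
Qed.

Lemma collisions_le_powR32 (R : realType) (T : finType) (f : nat -> T) N :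
  shift_sparse f N ->
  (collisions (fun i : 'I_N => f i))%:R <= 10 * N%:R `^ (3 / 2) :> R.
Proof.
move=> f_sparse; rewrite powR32_sqrt //; set s := Num.sqrt _.
case: N f_sparse @s => [|N] f_sparse s.
  by rewrite /collisions big_ord0 mul0r mulr0.
have s_sqr : s ^+ 2 = N.+1%:R by rewrite sqr_sqrtr.
have s_ge1 : 1 <= s by rewrite -sqrtr1 ler_wsqrtr // ler1n.
pose L := (Num.truncn s).+1.
have L_le : L%:R <= s + 1 by rewrite -natr1 lerD2r truncn_le sqrtr_ge0.
have lt_sL : s < L%:R := truncnS_gt s.
have N_le : (N.+1 <= L * L)%N by rewrite -(ler_nat R) natrM; nra.
have := collisions_blocks_le N_le (ltn0Sn _) f_sparse.
rewrite -(ler_nat R) natrM natrD natrX -s_sqr => /le_trans -> //.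
have L_le_2s : L%:R <= 2 * s by lra.
have -> : 10 * (s ^+ 2 * s) = 2 * s * (s ^+ 2 + (2 * s) ^+ 2) by ring.
by rewrite ler_pM ?addr_ge0 ?sqr_ge0 // lerD2l lerXn2r // nnegrE; lra.
Qed.

Lemma eqr_nat_pchar (R : nzRingType) p m n : p \in [pchar R] ->
  (m%:R == n%:R :> R) = (m == n %[mod p]).
Proof.
move=> pcharR; wlog le_mn : m n / (m <= n)%N => [hwlog|].
  by case/orP: (leq_total m n) => /hwlog // eq_nm; rewrite eq_sym eq_nm eq_sym.
rewrite eq_sym [RHS]eq_sym eqn_mod_dvd // (dvdn_pcharf pcharR) natrB //.
by rewrite subr_eq0.
Qed.

Lemma natr_inj_pchar (R : nzRingType) p : p \in [pchar R] ->
  {in gtn p &, injective (fun n => n%:R : R)}.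
Proof.
move=> pcharR m n lt_mp lt_np /eqP.
by rewrite (eqr_nat_pchar _ _ pcharR) !modn_small // => /eqP.
Qed.

Lemma natr_fact_neq0 (R : idomainType) p n : p \in [pchar R] ->
  (n < p)%N -> n`!%:R != 0 :> R.
Proof.
move=> pcharR lt_np; rewrite fact_prod natr_prod big_seq.
apply: (big_ind (fun x : R => x != 0)) => [|x y|k]; rewrite ?oner_neq0 //.
  exact: mulf_neq0.
rewrite mem_index_iota => /andP[k_gt0 le_kn].
by rewrite -(dvdn_pcharf pcharR) gtnNdvd // (leq_ltn_trans _ lt_np).
Qed.

Definition ffact_poly (R : nzRingType) k : {poly R} :=
  \prod_(i < k) ('X - (i%:R)%:P).

Lemma size_ffact_poly (R : nzRingType) k : size (ffact_poly R k) = k.+1.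
Proof.
by rewrite size_prod_XsubC [index_enum _]unlock -enumT size_enum_ord.
Qed.

Lemma horner_ffact_poly (R : comNzRingType) k n :
  (ffact_poly R k).[n%:R] = (n ^_ k)%:R.
Proof.
rewrite horner_prod ffact_prod natr_prod.
have [le_kn|lt_nk] := leqP k n.
  apply: eq_bigr => i _; rewrite hornerXsubC natrB //.
  exact: leq_trans (ltnW (ltn_ord i)) le_kn.
rewrite [LHS](bigD1 (Ordinal lt_nk)) // [RHS](bigD1 (Ordinal lt_nk)) //=.
by rewrite hornerXsubC subrr subnn !mul0r.
Qed.

Lemma root_ffact_poly_sub1 (R : idomainType) m k : m`!%:R != 0 :> R ->
  m`!%:R = (m + k)`!%:R :> R -> root (ffact_poly R k - 1) (m + k)%:R.
Proof.
move=> fact_neq0; rewrite -(@ffact_fact (m + k) k) ?leq_addl // addnK natrM.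
rewrite rootE !hornerE horner_ffact_poly subr_eq0 -(inj_eq (mulIf fact_neq0)).
by rewrite mul1r => <-.
Qed.

Lemma shift_sparse_fact (R : idomainType) p m N : p \in [pchar R] ->
  (m + N <= p)%N -> shift_sparse (fun i => (m + i)`!%:R : R) N.
Proof.
move=> pcharR le_p k k_gt0.
pose P i := (m + i)`!%:R == (m + (i + k))`!%:R :> R.
pose roots := [seq (m + (i + k))%:R : R | i <- iota 0 (N - k) & P i].
have size_sub1 : size (ffact_poly R k - 1) = k.+1.
  by rewrite size_polyDl size_ffact_poly // size_polyN size_poly1 ltnS.
have -> : shift_collisions (fun i => (m + i)`!%:R : R) N k = size roots.
  rewrite /shift_collisions /index_iota subn0 size_map size_filter -sum1_count.
  by rewrite [RHS]big_mkcond.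
rewrite -ltnS -size_sub1 max_poly_roots //.
- by rewrite -size_poly_eq0 size_sub1.
- apply/allP => _ /mapP[i + ->]; rewrite mem_filter mem_iota.
  move=> /andP[/eqP P_i lt_i].
  rewrite addnA root_ffact_poly_sub1 -?addnA // (natr_fact_neq0 pcharR) //.
  by lia.
- rewrite map_inj_in_uniq ?filter_uniq ?iota_uniq // => i j.
  rewrite !mem_filter !mem_iota => /andP[_ lt_i] /andP[_ lt_j].
  by move/(natr_inj_pchar pcharR); rewrite !inE; lia.
Qed.

Lemma fact_collisions_le (R : realType) p H N : prime p -> (H + N < p)%N ->
  (collisions (fun i : 'I_N => (H.+1 + i)`!%:R : 'F_p))%:R
    <= 10 * N%:R `^ (3 / 2) :> R.
Proof.
move=> p_pr lt_p.
apply: (collisions_le_powR32 R (f := fun i => (H.+1 + i)`!%:R : 'F_p)).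
exact: shift_sparse_fact (pchar_Fp p_pr) _.
Qed.

Lemma sum_expr_unity_root (R : idomainType) n (z : R) : n.-unity_root z ->
  \sum_(k < n) z ^+ k = if z == 1 then n%:R else 0.
Proof.
move=> /unity_rootP zn1; have [->|z_neq1] := eqVneq z 1.
  by under eq_bigr do rewrite expr1n; rewrite sumr_const card_ord.
have /esym/eqP := subrX1 z n.
by rewrite zn1 subrr mulf_eq0 subr_eq0 (negPf z_neq1) => /eqP.
Qed.

Lemma norm_prim_root (C : numClosedFieldType) n (w : C) :
  n.-primitive_root w -> `|w| = 1.
Proof.
move=> w_prim; apply/eqP; rewrite -(pexpr_eq1 (prim_order_gt0 w_prim)) //.
by rewrite -normrX prim_expr_order // normr1.
Qed.

Lemma prim_root_orthogonality (C : numClosedFieldType) n (w : C) k l :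
  n.-primitive_root w ->
  \sum_(a < n) w ^+ (a * k) * (w ^+ (a * l))^*%R
    = if k == l %[mod n] then n%:R else 0.
Proof.
move=> w_prim; pose z := w ^+ k * (w ^+ l)^*%R.
under eq_bigr => a _ do rewrite !(mulnC a) !exprM rmorphXn -exprMn -/z.
have z_root : n.-unity_root z.
  apply/unity_rootP; rewrite exprMn -rmorphXn -!exprM !(mulnC _ n) !exprM.
  by rewrite (prim_expr_order w_prim) !expr1n rmorph1 mulr1.
have w_conj : w ^+ l * (w ^+ l)^*%R = 1.
  by rewrite -normCK normrX (norm_prim_root w_prim) !expr1n.
have conj_neq0 : (w ^+ l)^*%R != 0.
  by apply: contra_eq_neq w_conj => ->; rewrite mulr0 eq_sym oner_neq0.
have z_eq1 : (z == 1) = (k == l %[mod n]).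
  rewrite -w_conj (inj_eq (mulIf conj_neq0)).
  exact: eq_prim_root_expr w_prim _ _.
by rewrite sum_expr_unity_root // z_eq1.
Qed.

Lemma prim_root_parseval (C : numClosedFieldType) n (w : C) (I : finType)
    (f : I -> nat) : n.-primitive_root w ->
  \sum_(a < n) `|\sum_i w ^+ (a * f i)| ^+ 2
    = n%:R * (collisions (fun i => f i %% n)%N)%:R.
Proof.
move=> w_prim.
under eq_bigr do rewrite normCK rmorph_sum big_distrlr.
rewrite exchange_big natr_sum mulr_sumr; apply: eq_bigr => i _ /=.
rewrite exchange_big natr_sum mulr_sumr; apply: eq_bigr => j _ /=.
by rewrite prim_root_orthogonality // mulr_natr mulrb.
Qed.

Lemma eexpE (R : realType) p (x : R) :
  eexp p x = cos (2 * pi * x / p%:R) +i* sin (2 * pi * x / p%:R).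
Proof. by rewrite /eexp /cexp /= expR0 mul1r. Qed.

Lemma eexpD (R : realType) p (x y : R) : eexp p (x + y) = eexp p x * eexp p y.
Proof.
rewrite !eexpE mulrDr mulrDl cosD sinD.
by apply/eqP; rewrite eq_complex /= eqxx /= addrC.
Qed.

Lemma eexp_nat (R : realType) p n : eexp p (n%:R : R) = eexp p 1 ^+ n.
Proof.
elim: n => [|n IHn]; last by rewrite -natr1 eexpD IHn exprSr.
by rewrite eexpE mulr0 mul0r cos0 sin0.
Qed.

Lemma cos_lt1 (R : realType) (x : R) : 0 < x < pi *+ 2 -> cos x < 1.
Proof.
move=> /andP[x_gt0 x_lt].
have sin_gt0 : 0 < sin (x / 2).
  by apply: sin_gt0_pi; rewrite divr_gt0 //= ltr_pdivrMr // mulr_natr.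
have -> : cos x = 1 - sin (x / 2) ^+ 2 *+ 2.
  rewrite -[X in cos X](@divfK _ 2) ?pnatr_eq0 // mulr_natr cos_mulr2n cos2sin2.
  by ring.
by rewrite ltrBlDr ltrDl pmulrn_lgt0 // exprn_gt0.
Qed.

Lemma eexp_prim_root (R : realType) p : (0 < p)%N ->
  p.-primitive_root (eexp p (1 : R)).
Proof.
move=> p_gt0; have p_gt0R : 0 < p%:R :> R by rewrite ltr0n.
have eexp_p : eexp p (1 : R) ^+ p = 1.
  by rewrite -eexp_nat eexpE mulfK ?gt_eqF // mulr_natl cos2pi sin2pi.
have [m m_prim m_dvd] := prim_order_exists p_gt0 eexp_p.
move: (dvdn_leq p_gt0 m_dvd); rewrite leq_eqVlt => /orP[/eqP m_eq|lt_mp].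
  by rewrite m_eq in m_prim.
have := prim_expr_order m_prim; rewrite -eexp_nat eexpE => -[cos_eq1 _].
suff : cos (2 * pi * m%:R / p%:R : R) < 1 by rewrite cos_eq1 ltxx.
have pi2_gt0 : 0 < pi *+ 2 :> R by rewrite pmulrn_lgt0 // pi_gt0.
apply: cos_lt1; rewrite mulr_natl ltr_pdivrMr // ltr_pM2l // ltr_nat lt_mp.
by rewrite andbT divr_gt0 // mulr_gt0 // ltr0n (prim_order_gt0 m_prim).
Qed.

Lemma fact_expsum_parseval (R : realType) p H N : prime p ->
  \sum_(a : 'F_p) `|fact_expsum R a H N| ^+ 2
    = p%:R * (collisions (fun i : 'I_N => (H.+1 + i)`!%:R : 'F_p))%:R.
Proof.
move=> p_pr.
rewrite (eq_collisions (g := fun i : 'I_N => (H.+1 + i)`! %% p)%N); last first.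
  by move=> i j; rewrite (eqr_nat_pchar _ _ (pchar_Fp p_pr)).
rewrite -(prim_root_parseval _ (eexp_prim_root R (prime_gt0 p_pr))).
pose F (a : nat) := `|\sum_(i < N) eexp p (1 : R) ^+ (a * (H.+1 + i)`!)| ^+ 2.
transitivity (\sum_(a : 'F_p) F a); last first.
  by rewrite -(big_mkord xpredT F) Fp_cast // big_mkord.
apply: eq_bigr => a _; rewrite /F /fact_expsum; congr (`|_| ^+ 2).
rewrite -addSn -{1}[H.+1]add0n big_addn addKn big_mkord.
by apply: eq_bigr => i _; rewrite -natrM eexp_nat addnC.
Qed.

Theorem theorem5 (R : realType) :
  exists2 C : R, 0 < C &
    forall p H N : nat,
      prime p -> odd p -> (H < H + N < p)%N ->
      \sum_(a : 'F_p) `|fact_expsum R a H N| ^+ 2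
        <= (C * (p%:R * N%:R `^ (3 / 2)))%:C.
Proof.
exists 10; first by [].
move=> p H N p_pr _ /andP[_ lt_p].
rewrite fact_expsum_parseval //.
have := fact_collisions_le R p_pr lt_p; set J := collisions _ => J_le.
have -> : p%:R * J%:R = (p%:R * J%:R)%:C :> R[i].
  by rewrite rmorphM /= !rmorph_nat.
by rewrite lecR mulrCA ler_wpM2l.
Qed.
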